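(* Let $-\infty<\omega_*<\omega^*<+\infty$, $T>0$, $Z_f\in C^0([\omega_*,\omega^*])$ and $\eta>0$. There exists $w\in C^\infty_c((0,T))$ such that the solution of $$\dot Z(t,\omega)=i\omega Z(t,\omega)-w(t),\qquad Z(0,\omega)=0,$$ satisfies $\|Z(T)-Z_f\|_{L^\infty(\omega_*,\omega^* )}<\eta$.
   Context: All functions are complex-valued. *)

(* Defs.v *)
From HB Require Import structures.
From mathcomp Require Import all_boot all_order all_algebra.
From mathcomp Require Import complex.
From mathcomp Require Import all_classical all_reals all_analysis.

Set Implicit Arguments.
Unset Strict Implicit.
Unset Printing Implicit Defensive.

Import Order.TTheory GRing.Theory Num.Theory.
Import numFieldNormedType.Exports.

Local Open Scope classical_set_scope.
Local Open Scope ring_scope.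

(* Rcomplex R is the field R[i] viewed as a real vector space, with the
   R-valued modulus as norm. It only lacks the topology of this norm, which is
   needed to differentiate functions R -> Rcomplex R. *)
Section Rcomplex_normedModType.
Variable R : realType.

HB.instance Definition _ :=
  PseudoMetric.copy (Rcomplex R) (pseudoMetric_normed (Rcomplex R)).

HB.instance Definition _ := isPointed.Build (Rcomplex R) 0.

HB.instance Definition _ :=
  NormedZmod_PseudoMetric_eq.Build R (Rcomplex R) erefl.

Lemma Rcomplex_normrZ (l : R) (z : Rcomplex R) : `|l *: z| = `|l| * `|z|.
Proof.
case: z => x y; rewrite /Num.norm /= !exprMn -mulrDr sqrtrM ?sqr_ge0 //.
by rewrite sqrtr_sqr.
Qed.

HB.instance Definition _ :=
  PseudoMetricNormedZmod_Lmodule_isNormedModule.Build R (Rcomplex R)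
    Rcomplex_normrZ.

End Rcomplex_normedModType.

Section defs.
Variable R : realType.
Implicit Types (w : R -> Rcomplex R) (T a b : R).

(* C^oo_c((0, T)), its elements being extended by 0 to the whole line. The
   derivatives are those of functions from R to the real normed space
   Rcomplex R. *)
Definition test_function T w :=
  [/\ forall (n : nat) (t : R), derivable (w^`(n))%classic t 1,
      compact (closure [set t | w t != 0]) &
      closure [set t | w t != 0] `<=` `]0, T[].

(* Z : t -> omega -> C solves dZ/dt = i omega Z - w(t), Z(0, omega) = 0 on
   [0, T] x [a, b]; only the values of Z on this rectangle matter. Continuity on
   the closed interval links the open-interval equation to the initial value
   and to the value at time T. *)
Definition solution a b T w (Z : R -> R -> Rcomplex R) :=
  forall omega : R, omega \in `[a, b] ->
    [/\ Z 0 omega = 0,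
        {within `[0, T], continuous (fun t => Z t omega)} &
        forall t : R, t \in `]0, T[ ->
          is_derive t 1 (fun s => Z s omega)
            (((omega *i)%C : Rcomplex R) * Z t omega - w t)].

(* The essential supremum of |f| for the Lebesgue measure on ]a, b[. *)
Definition Linfty_norm a b (f : R -> Rcomplex R) : \bar R :=
  Lnorm (mrestr lebesgue_measure (measurable_itv `]a, b[)) +oo%E
    (fun x => `|f x|%:E).

End defs.

(* Main.v *)
Require Import Defs.
From mathcomp Require Import all_boot all_order all_algebra.
From mathcomp Require Import complex ring lra.
From mathcomp Require Import all_classical all_reals all_analysis.
From mathcomp Require Import ess_sup_inf.
Set Implicit Arguments.
Unset Strict Implicit.
Unset Printing Implicit Defensive.
Import Order.TTheory GRing.Theory Num.Theory.
Import numFieldNormedType.Exports.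
Local Open Scope classical_set_scope.
Local Open Scope ring_scope.

(** The controls have one algebraic feature that settles everything. If [Z]
    solves the equation [Z' = i omega Z - w] from rest, then
    [omega Z + i w] solves it from rest for the control [- i w'], as one sees by
    differentiating. Since [w] vanishes near [0] and near [T], the initial value
    stays zero and the value at time [T] becomes [omega Z(T, omega)]. Hence the
    set of profiles [omega |-> Z(T, omega)] reached by smooth controls supported
    in a fixed [[c, d]] inside [(0, T)] is a complex vector space stable under
    multiplication by [omega], that is, a module over the complex polynomials
    in [omega] ([reachable_cpoly]).

    It thus suffices to reach one continuous profile [H] without zeros on
    [[a, b]] ([reachable_nonvanishing]): polynomials approximate [Zf / H]
    uniformly on [[a, b]] ([weierstrass]), and multiplying by the bounded
    function [H] gives the approximation of [Zf] ([reachable_dense]). For [H],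
    take the control [w = - f] with [f] a nonnegative smooth bump around
    [m = T / 2] ([bump_exists]). Up to a factor of modulus one, [H(omega)] is
    the integral of [exp(- i omega (t - m)) f(t)], and when the support of [f] is so
    short that [|omega (t - m)| < 1] on it, the real part of the integrand is
    nonnegative and not identically zero.

    The work is done on real and imaginary parts: a complex solution is a
    pair [(X, Y)] with [X' = - omega Y - w1] and [Y' = omega X - w2].
    Uniqueness holds because the squared modulus of the difference of two
    solutions is constant in time. *)

(** * Smooth functions of a real variable *)

Section Smooth.
Variable R : realType.
Implicit Types (f g : R -> R) (t : R).

Definition smooth f := forall (n : nat) (t : R), derivable (f^`(n))%classic t 1.

Lemma smooth_is_derive f t : smooth f -> is_derive t 1 f (f^`()%classic t).
Proof. by move=> sf; rewrite derive1E; apply: derivableP; apply: (sf 0%N). Qed.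

Lemma smooth_derive1 f : smooth f -> smooth (f^`())%classic.
Proof. by move=> sf n t; rewrite -derive1Sn; exact: sf. Qed.

Lemma smooth_continuous f : smooth f -> continuous f.
Proof.
move=> sf t; apply: differentiable_continuous.
by apply/derivable1_diffP; exact: (sf 0%N).
Qed.

(** A class of functions stable under derivation consists of smooth functions.
    The smoothness proofs below rest on such classes instead of formulas for the
    iterated derivatives. *)
Lemma smooth_class (S : set (R -> R)) :
  (forall f, S f -> exists2 f', S f' & forall t : R, is_derive t 1 f (f' t)) ->
  forall f, S f -> smooth f.
Proof.
move=> HS f Sf n; elim: n => [|n IHn] in f Sf * => t.
  by have [f' _ df] := HS _ Sf; exact: ex_derive.
have [f' Sf' df] := HS _ Sf; rewrite derive1Sn.
suff -> : (f^`())%classic = f' by exact: IHn.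
by apply/funext => s; rewrite derive1E; have [_ ->] := df s.
Qed.

Lemma smoothD f g : smooth f -> smooth g -> smooth (fun t => f t + g t).
Proof.
move=> sf sg; pose S := [set h : R -> R | exists f1 f2,
  [/\ smooth f1, smooth f2 & h = (fun t => f1 t + f2 t)]].
apply: (@smooth_class S); last by exists f, g.
move=> _ [f1 [f2 [s1 s2 ->]]].
exists (fun t => (f1^`())%classic t + (f2^`())%classic t).
  exists (f1^`())%classic, (f2^`())%classic.
  by split; [exact: smooth_derive1 s1|exact: smooth_derive1 s2|].
by move=> t; apply: is_deriveD; exact: smooth_is_derive.
Qed.

Lemma smoothZ (k : R) f : smooth f -> smooth (fun t => k * f t).
Proof.
move=> sf; pose S := [set h : R -> R | exists2 f1,
  smooth f1 & h = (fun t => k * f1 t)].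
apply: (@smooth_class S); last by exists f.
move=> _ [f1 s1 ->].
exists (fun t => k * (f1^`())%classic t).
  by exists (f1^`())%classic; [exact: smooth_derive1 s1|].
by move=> t; apply: is_deriveZ; exact: smooth_is_derive.
Qed.

Lemma smoothN f : smooth f -> smooth (fun t => - f t).
Proof.
move=> sf; have := @smoothZ (-1) f sf; congr smooth.
by apply/funext => t; rewrite mulN1r.
Qed.

(** The Leibniz rule turns a product into a sum of two products, so sums are
    needed for a class visibly stable under derivation. *)
Inductive sum_of_products : (R -> R) -> Prop :=
| SumProd f g : smooth f -> smooth g -> sum_of_products (fun t => f t * g t)
| SumAdd h k : sum_of_products h -> sum_of_products k ->
    sum_of_products (fun t => h t + k t).

Lemma smoothM f g : smooth f -> smooth g -> smooth (fun t => f t * g t).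
Proof.
move=> sf sg; apply: (@smooth_class sum_of_products); last exact: SumProd.
move=> h; elim=> [{}f {}g {}sf {}sg|h1 h2 _ [h1' S1 D1] _ [h2' S2 D2]]; last first.
  exists (fun t => h1' t + h2' t); first exact: SumAdd.
  by move=> t; apply: is_deriveD.
exists (fun t => f t * (g^`())%classic t + g t * (f^`())%classic t).
  by apply: SumAdd; apply: SumProd; [|exact: smooth_derive1| |exact: smooth_derive1].
by move=> t; apply: is_deriveM; exact: smooth_is_derive.
Qed.

Lemma is_derive_affine f (k m t df : R) : is_derive (k * t + m) 1 f df ->
  is_derive t 1 (fun s => f (k * s + m)) (k * df).
Proof.
move=> D.
have Da : is_derive t 1 (fun s : R => k * s + m) k.
  have D1 := @is_deriveD R R R _ _ t 1 _ _
    (@is_deriveZ R R R id k t 1 1 (is_derive_id t 1)) (is_derive_cst m t 1).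
  by apply: (is_derive_eq D1); rewrite addr0; exact: mulr1.
rewrite mulrC; exact: (@is_derive1_comp R f (fun s => k * s + m) t df k D Da).
Qed.

Lemma smooth_affine f (k m : R) : smooth f -> smooth (fun t => f (k * t + m)).
Proof.
move=> sf; pose S := [set h : R -> R | exists l f1,
  smooth f1 /\ h = (fun t => l * f1 (k * t + m))].
apply: (@smooth_class S); last first.
  by exists 1, f; split; [exact: sf|]; apply/funext => t; rewrite mul1r.
move=> _ [l [f1 [s1 ->]]].
exists (fun t => (l * k) * (f1^`())%classic (k * t + m)).
  by exists (l * k), (f1^`())%classic; split; [exact: smooth_derive1 s1|].
move=> t; rewrite -mulrA; apply: is_deriveZ; apply: is_derive_affine.
exact: smooth_is_derive.
Qed.

End Smooth.

(** * A smooth bump *)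

Section Bump.
Variable R : realType.
Implicit Types (p : {poly R}) (f : R -> R).

(** The difference quotient at [0] is bounded by [C * |h|]. *)
Lemma is_derive0_quadratic f (C : R) :
  (forall x : R, `|f x| <= C * x ^+ 2) -> is_derive (0 : R) 1 f 0.
Proof.
move=> Hf.
have f0 : f 0 = 0.
  by apply/eqP; rewrite -normr_le0 (le_trans (Hf 0)) // expr0n mulr0.
suff lim0 : h^-1 *: ((f \o shift 0) (h *: (1 : R)) - f 0) @[h --> 0^'] --> (0 : R).
  apply: DeriveDef; first by apply/cvg_ex; exists 0.
  exact: cvg_lim lim0.
apply/cvgr0Pnorm_lt => e e0.
have C0 : 0 <= C by rewrite -[C]mulr1 -(expr1n R 2); exact: le_trans (Hf 1).
near=> h.
have hN0 : h != 0 by near: h; exact: nbhs_dnbhs_neq.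
have hpos : 0 < `|h| by rewrite normr_gt0.
rewrite /= f0 subr0 addr0 normrZ normfV [h%:A]mulr1 mulrC ltr_pdivrMr //.
apply: le_lt_trans (Hf h) _.
rewrite -(ger0_norm (sqr_ge0 h)) normrX expr2 mulrA ltr_pM2r //.
apply: (@le_lt_trans _ _ ((C + 1) * `|h|)); first by rewrite ler_pM2r // lerDl.
rewrite mulrC -ltr_pdivlMr; last exact: ltr_wpDl.
near: h; apply: dnbhs0_lt; apply: divr_gt0 => //; exact: ltr_wpDl.
Unshelve. all: by end_near. Qed.

(** For [y > 0] each monomial satisfies [y ^+ i <= i`! * expR y], by the power
    series of the exponential. *)
Lemma poly_expRN_bounded p : exists C : R,
  forall y : R, 0 < y -> `|p.[y]| * expR (- y) <= C.
Proof.
exists (\sum_(i < size p) `|p`_i| * i`!%:R) => y y0.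
rewrite horner_coef expRN ler_pdivrMr ?expR_gt0 // mulr_suml.
apply: le_trans (ler_norm_sum _ _ _) _; apply: ler_sum => i _.
rewrite normrM -mulrA; apply: ler_wpM2l => //.
rewrite normrX (gtr0_norm y0) mulrC -ler_pdivrMr; last by rewrite ltr0n fact_gt0.
case: (nat_of_ord i) => [|n].
  by rewrite expr0 divr1 -expR0 ler_expR ltW.
by apply: le_trans (expR_ge1Dxn n (ltW y0)); rewrite lerDr.
Qed.

(** For [p = 1] this is the classical smooth function that is flat at the
    origin. Allowing a polynomial in [x^-1] as a factor makes the family stable
    under derivation. *)
Definition flat p (x : R) : R := if 0 < x then p.[x^-1] * expR (- x^-1) else 0.

(** Writing [y = x^-1], the quotient by [x ^+ 2] is the function
    [y ^+ 2 * p.[y] * expR (- y)], which is bounded. *)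
Lemma flat_quadratic p : exists C : R, forall x : R, `|flat p x| <= C * x ^+ 2.
Proof.
have [C HC] := poly_expRN_bounded (p * 'X ^+ 2); exists C => x.
have C0 : 0 <= C by apply: le_trans (HC 1 ltr01); rewrite mulr_ge0 // expR_ge0.
rewrite /flat; case: ifP => [x0|_]; last by rewrite normr0 mulr_ge0 // sqr_ge0.
have := HC x^-1; rewrite invr_gt0 => /(_ x0).
rewrite hornerM hornerXn !normrM (ger0_norm (expR_ge0 _)).
rewrite (gtr0_norm (_ : 0 < x^-1)) ?invr_gt0 // => H.
rewrite -ler_pdivrMr ?exprn_gt0 //; apply: le_trans H.
by rewrite -exprVn expr2 mulrAC.
Qed.

(** On the right of [0] this is the chain rule; at [0] the derivative is zero
    because the function is bounded by a multiple of [x ^+ 2]. *)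
Lemma flat_derive p (x : R) :
  is_derive x 1 (flat p) (flat ('X ^+ 2 * (p - p^`())) x).
Proof.
have [x0|x0|->] := ltgtP x 0.
- rewrite (_ : flat ('X ^+ 2 * (p - p^`())) x = 0); last first.
    by rewrite /flat ltNge (ltW x0).
  apply: (@near_eq_is_derive _ _ _ (cst 0)).
  near=> y; rewrite /flat ltNge (_ : y <= 0) //.
  by apply/ltW; near: y; exact: lt_nbhsl.
- have DV : is_derive x 1 (fun y : R => y^-1) (- x^-2).
    have := @is_deriveV R id x 1 1; rewrite /GRing.scale /= mulr1; apply.
    by rewrite gt_eqF.
  have DP := @is_derive1_comp R (horner p) (fun y => y^-1) x _ _
    (is_derive_poly p x^-1) DV.
  have DE := @is_derive1_comp R expR (fun y => - y^-1) x _ _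
    (is_derive_expR _) (@is_deriveN _ _ _ _ _ _ _ DV).
  have := @is_deriveM _ _ _ _ _ _ _ _ DP DE.
  move=> /(near_eq_is_derive _) D; apply: (is_derive_eq (D _ _)) => {D}.
    by near=> y; rewrite /flat (_ : 0 < y) //; near: y; exact: lt_nbhsr.
  rewrite /flat x0 !hornerE /= /GRing.scale /= exprVn opprK.
  ring.
have [C HC] := flat_quadratic p.
rewrite (_ : flat ('X ^+ 2 * (p - p^`())) 0 = 0); last by rewrite /flat ltxx.
exact: is_derive0_quadratic HC.
Unshelve. all: by end_near. Qed.

Lemma smooth_flat p : smooth (flat p).
Proof.
apply: (@smooth_class _ [set f | exists q, f = flat q]); last by exists p.
move=> _ [q ->]; exists (flat ('X ^+ 2 * (q - q^`()))); last exact: flat_derive.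
by exists ('X ^+ 2 * (q - q^`())).
Qed.

Lemma flat1_gt0 (x : R) : 0 < x -> 0 < flat 1 x.
Proof. by move=> x0; rewrite /flat x0 hornerC mul1r expR_gt0. Qed.

Lemma flat1_eq0 (x : R) : x <= 0 -> flat 1 x = 0.
Proof. by move=> x0; rewrite /flat ltNge x0. Qed.

Lemma flat1_le1 (x : R) : flat 1 x <= 1.
Proof.
rewrite /flat; case: ifP => // x0.
by rewrite hornerC mul1r expR_le1 oppr_le0 invr_ge0 ltW.
Qed.

Lemma flat1_ge0 (x : R) : 0 <= flat 1 x.
Proof. by case: (leP x 0) => [/flat1_eq0->//|/flat1_gt0/ltW]. Qed.

(** The product of two flat functions, one vanishing up to [c] and the other
    from [d] on. *)
Lemma bump_exists (c d : R) : exists f, [/\ smooth f,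
  forall t, ~~ (c < t < d) -> f t = 0, forall t, c < t < d -> 0 < f t &
  forall t, 0 <= f t <= 1].
Proof.
exists (fun t => flat 1 (1 * t + - c) * flat 1 (-1 * t + d)); split.
- by apply: smoothM; apply: smooth_affine; exact: smooth_flat.
- move=> t; rewrite negb_and -!leNgt => /orP[tc|dt].
    by rewrite flat1_eq0 ?mul0r // mul1r subr_le0.
  by rewrite mulrC flat1_eq0 ?mul0r // mulN1r addrC subr_le0.
- move=> t /andP[ct td]; apply: mulr_gt0; apply: flat1_gt0.
    by rewrite mul1r subr_gt0.
  by rewrite mulN1r addrC subr_gt0.
- move=> t; rewrite mulr_ge0 ?flat1_ge0 //=.
  by rewrite mulr_ile1 ?flat1_ge0 ?flat1_le1.
Qed.

End Bump.

(** * Weierstrass approximation *)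

Section Weierstrass.
Variable R : realType.
Implicit Types (f : R -> R) (phi psi : nat -> R) (a b : R).

(** Near each point, half of the radius given by continuity for [e / 2] works as
    a uniform radius; compactness of the segment makes it global. *)
Lemma segment_uniform_continuity f a b :
  {within `[a, b], continuous f} -> forall e : R, 0 < e ->
  exists2 d : R, 0 < d & forall x y, a <= x <= b -> a <= y <= b ->
    `|x - y| < d -> `|f x - f y| < e.
Proof.
move=> cf e e0.
have /compact_near_coveringP K := @segment_compact R a b.
have [] := K R (0 : R)^'+ (fun d x => a <= x <= b -> forall y, a <= y <= b ->
    `|x - y| < d -> `|f x - f y| < e) _ _; last first.
  move=> r /= r0 Hr; exists (r / 2); first by apply: divr_gt0.
  move=> x y xab yab xy; apply: (Hr (r / 2)) => //=.
  - by rewrite sub0r normrN gtr0_norm ?divr_gt0 // ltr_pdivrMr // ltr_pMr // ltr1n.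
  - by apply: divr_gt0.
move=> x /= xab.
have /cvgrPdist_lt /(_ _ (divr_gt0 e0 (ltr0n R 2))) := cf x.
rewrite /prop_near1 /nbhs /= -nbhs_subspace_in //= => /nbhs_ballP[r /= r0 Hr].
near=> z d => /= zab y yab zy.
have xz : `|x - z| < r / 2.
  by near: z; apply: nbhsx_ballx; exact: divr_gt0.
have dr : d < r / 2 by near: d; apply: nbhs_right_lt; exact: divr_gt0.
rewrite (splitr e) (_ : f z - f y = (f x - f y) - (f x - f z)); last by ring.
apply: le_lt_trans (ler_normB _ _) _; apply: ltrD; apply: Hr => //=.
- change (`|x - y| < r); rewrite (_ : x - y = (x - z) + (z - y)); last by ring.
  rewrite (splitr r); apply: le_lt_trans (ler_normD _ _) _; apply: ltrD => //.
  exact: lt_trans dr.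
- change (`|x - z| < r); apply: lt_trans xz _.
  by rewrite ltr_pdivrMr // ltr_pMr // ltr1n.
Unshelve. all: by end_near. Qed.

Lemma segment_bounded f a b : a <= b -> {within `[a, b], continuous f} ->
  exists2 M : R, 0 < M & forall x, a <= x <= b -> `|f x| <= M.
Proof.
move=> ab cf.
have [c _ Hc] : exists2 c, c \in `[a, b] &
    forall t, t \in `[a, b] -> `|f t| <= `|f c|.
  apply: EVT_max => //.
  by move=> x; apply: continuous_comp; [exact: cf|exact: norm_continuous].
exists (`|f c| + 1); first exact: ltr_wpDl.
by move=> x xab; rewrite (le_trans (Hc _ _)) ?in_itv // lerDl.
Qed.

(** The Bernstein polynomial of the values [phi 0, ..., phi n], namely the mean
    of [phi] under the binomial law of parameters [n] and [X]. Conditioning on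
    the first trial gives this recursion, which avoids binomial coefficients:
    positivity and moments follow by induction on [n]. *)
Fixpoint bernstein n phi : {poly R} :=
  if n is m.+1 then
    (1 - 'X) * bernstein m phi + 'X * bernstein m (fun k => phi k.+1)
  else (phi 0%N)%:P.

Lemma bernstein_le n phi psi (x : R) : 0 <= x <= 1 ->
  (forall k, (k <= n)%N -> phi k <= psi k) ->
  (bernstein n phi).[x] <= (bernstein n psi).[x].
Proof.
move=> /andP[x0 x1]; elim: n phi psi => [|n IHn] phi psi H /=.
  by rewrite !hornerC H.
rewrite !hornerE; apply: lerD; apply: ler_wpM2l; rewrite ?subr_ge0 //.
  by apply: IHn => k kn; apply: H; exact: leqW.
by apply: IHn => k kn; exact: H.
Qed.

(** The binomial law has mean [n x] and variance [n x (1 - x)]. *)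
Lemma bernstein_quadratic n (u v c x : R) :
  (bernstein n (fun k => u + v * (k%:R - c) ^+ 2)).[x] =
  u + v * (n%:R * x * (1 - x) + (n%:R * x - c) ^+ 2).
Proof.
elim: n c => [|n IHn] c /=; first by rewrite hornerC; ring.
have -> : (fun k : nat => u + v * (k.+1%:R - c) ^+ 2) =
    (fun k => u + v * (k%:R - (c - 1)) ^+ 2).
  by apply/funext => k; rewrite -natr1; ring.
by rewrite !hornerE !IHn -natr1; ring.
Qed.

(** Bernstein's proof. By uniform continuity and boundedness, the oscillation
    [|f y - f x|] is at most [e / 2] plus a multiple of [(y - x) ^+ 2], so that
    positivity reduces the estimate to a second moment, which is [O(1 / n)]. *)
Lemma weierstrass f a b : a < b -> {within `[a, b], continuous f} ->
  forall e : R, 0 < e -> exists p : {poly R},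
    forall x, a <= x <= b -> `|p.[x] - f x| <= e.
Proof.
move=> ab cf e e0.
have [d d0 Hd] := segment_uniform_continuity cf (divr_gt0 e0 (ltr0n R 2)).
have [M M0 HM] := segment_bounded (ltW ab) cf.
pose l := b - a; have l0 : 0 < l by rewrite subr_gt0.
(* If [|x - y| >= d], the oscillation, at most [2 * M], is bounded by
   [2 * M * ((x - y) / d) ^+ 2]; [D] is the resulting coefficient in the
   coordinate on [[0, 1]]. *)
pose D := 2 * M * (l / d) ^+ 2.
have D0 : 0 <= D by rewrite mulr_ge0 ?sqr_ge0 // mulr_ge0 // ltW.
pose n := (Num.truncn (2 * D / e)).+1.
have nD : D / n%:R <= e / 2.
  rewrite ler_pdivrMr ?ltr0n // mulrAC ler_pdivlMr // mulrC.
  rewrite [X in _ <= X]mulrC -ler_pdivrMr //.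
  by apply: ltW; exact: truncnS_gt.
(* [s], the barycentric coordinate of [x] in [[a, b]], is the argument of the
   Bernstein polynomial; the node [k / n] of [[0, 1]] is sent to [[a, b]]. *)
pose phi k := f (a + l * (k%:R / n%:R)).
exists (bernstein n phi \Po (l^-1 *: ('X - a%:P))) => x xab.
rewrite horner_comp hornerZ hornerXsubC.
set s := _ * _.
have xE : x = a + l * s by rewrite /s mulrA mulfV ?gt_eqF // mul1r; ring.
have s01 : 0 <= s <= 1.
  move: xab; rewrite xE => /andP[]; rewrite lerDl pmulr_rge0 // => ->.
  by rewrite -lerBrDl -/l ger_pMr.
have n0 : (n%:R : R) != 0 by rewrite pnatr_eq0.
have osc k : (k <= n)%N ->
    `|phi k - f x| <= e / 2 + D / n%:R ^+ 2 * (k%:R - n%:R * s) ^+ 2.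
  move=> kn; set y := a + l * (k%:R / n%:R).
  have yab : a <= y <= b.
    rewrite /y lerDl mulr_ge0 ?(ltW l0) ?divr_ge0 //=.
    by rewrite -lerBrDl -/l ger_pMr // ler_pdivrMr ?ltr0n // mul1r ler_nat.
  have yx : y - x = l / n%:R * (k%:R - n%:R * s).
    by rewrite /y xE; field.
  have -> : D / n%:R ^+ 2 * (k%:R - n%:R * s) ^+ 2 = 2 * M * ((y - x) / d) ^+ 2.
    by rewrite yx /D; field; rewrite n0 gt_eqF.
  have [yxd|dyx] := ltP `|y - x| d.
    apply: (le_trans (ltW (Hd _ _ yab xab yxd))).
    by rewrite lerDl mulr_ge0 ?sqr_ge0 // mulr_ge0 // ltW.
  apply: le_trans (ler_normB _ _) _; apply: ler_wpDl; first by rewrite ltW ?divr_gt0.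
  apply: (@le_trans _ _ (2 * M)).
    by rewrite mulrDl mul1r; apply: lerD; exact: HM.
  rewrite ler_pMr ?mulr_gt0 // -[X in _ <= X]ger0_norm ?sqr_ge0 //.
  rewrite normrX; apply: exprn_ege1; rewrite normrM normfV (gtr0_norm d0).
  by rewrite ler_pdivlMr // mul1r.
pose q := D / n%:R ^+ 2.
have qe : q * (n%:R * s * (1 - s)) <= e / 2.
  apply: le_trans nD.
  have -> : q * (n%:R * s * (1 - s)) = D / n%:R * (s * (1 - s)).
    by rewrite /q; field.
  move: s01 => /andP[s0 s1]; apply: ler_piMr; first by rewrite divr_ge0.
  by apply: mulr_ile1; rewrite ?subr_ge0 // lerBlDr lerDl.
have bnd u v : u + v * (n%:R * s * (1 - s)) =
    (bernstein n (fun k => u + v * (k%:R - n%:R * s) ^+ 2)).[s].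
  by rewrite bernstein_quadratic subrr expr0n addr0.
rewrite ler_norml; apply/andP; split.
  rewrite lerBrDr; apply: (@le_trans _ _ ((f x - e / 2) + (- q) * (n%:R * s * (1 - s)))).
    by move: qe; lra.
  rewrite bnd; apply: bernstein_le => // k /osc.
  by rewrite ler_norml => /andP[+ _]; rewrite -/q; lra.
rewrite lerBlDr; apply: (@le_trans _ _ ((f x + e / 2) + q * (n%:R * s * (1 - s)))).
  rewrite bnd; apply: bernstein_le => // k /osc.
  by rewrite ler_norml => /andP[_]; rewrite -/q; lra.
by move: qe; lra.
Qed.

End Weierstrass.

(** * Reachable targets *)

Section Reachable.
Variable R : realType.
Implicit Types (f w : R -> R) (c d T : R) (P Q : {poly R}).

(** The integral is taken from [-1] because the fundamental theorem of calculus
    only gives the derivative to the right of the base point, and the primitive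
    has to be differentiable at [0]. *)
Lemma continuous_primitive f : continuous f -> exists F : R -> R,
  F 0 = 0 /\ forall t : R, -1 < t -> is_derive t 1 F (f t).
Proof.
move=> cf.
pose G (t : R) := (\int[lebesgue_measure]_(s in `[(-1)%R, t]) f s)%R.
exists (fun t => G t - G 0); split=> [|t t1]; first by rewrite subrr.
have ti : t < t + 1 by rewrite ltrDl.
have [|dG eG] := @continuous_FTC1_closed R f (-1) t _ ti _ t1 (cf t).
  apply: continuous_compact_integrable; first exact: segment_compact.
  exact: continuous_subspaceT.
have DG : is_derive t 1 G (f t).
  by rewrite -eG derive1E; exact: derivableP.
have := is_deriveB DG (is_derive_cst (G 0) t 1).
by rewrite subr0.
Qed.

Lemma MVT_after (F dF : R -> R) (x y : R) : 0 <= x -> x < y ->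
  (forall t : R, -1 < t -> is_derive t 1 F (dF t)) ->
  exists2 z, x < z < y & F y - F x = dF z * (y - x).
Proof.
move=> x0 xy dFt.
have D z : x <= z -> is_derive z 1 F (dF z).
  move=> xz; apply: dFt; apply: lt_le_trans xz; apply: lt_le_trans x0.
  by rewrite ltrN10.
have [z||z zxy E] := @MVT R F dF x y xy; last by exists z; rewrite // -in_itv.
  by rewrite in_itv => /andP[/ltW xz _]; exact: D.
apply: derivable_within_continuous => z; rewrite in_itv => /andP[xz _].
exact: (@ex_derive _ _ _ _ _ _ _ (D z xz)).
Qed.

Definition supported_in c d w := forall t, ~~ (c <= t <= d) -> w t = 0.

Lemma supported_derive1 c d w : smooth w -> supported_in c d w ->
  supported_in c d (w^`())%classic.
Proof.
move=> sw Hw t; rewrite negb_and -!ltNge => ht; rewrite derive1E.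
suff D : is_derive t 1 w 0 by have [_ ->] := D.
apply: (@near_eq_is_derive _ _ _ (cst 0)).
case/orP: ht => [tc|dt]; near=> y; rewrite Hw //= negb_and -!ltNge.
  by rewrite (_ : y < c) //; near: y; exact: lt_nbhsl.
by rewrite (_ : d < y) ?orbT //; near: y; exact: lt_nbhsr.
Unshelve. all: by end_near. Qed.

(** The function [omega |-> p omega + i q omega] is the value at time [T] of the
    solution [X + i Y] for the control [w1 + i w2]. The equation is required
    at all times after [-1], so that it holds in a neighbourhood of [[0, T]] and
    no one-sided derivative or separate continuity condition is involved. *)
Definition reachable c d T (p q : R -> R) := exists w1 w2 (X Y : R -> R -> R),
  [/\ smooth w1, smooth w2, supported_in c d w1, supported_in c d w2 &
    forall omega : R, [/\ X 0 omega = 0 /\ Y 0 omega = 0,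
      X T omega = p omega /\ Y T omega = q omega &
      forall t : R, -1 < t ->
        is_derive t 1 (X^~ omega) (- omega * Y t omega - w1 t) /\
        is_derive t 1 (Y^~ omega) (omega * X t omega - w2 t)]].

Lemma reachableD c d T p1 q1 p2 q2 :
  reachable c d T p1 q1 -> reachable c d T p2 q2 ->
  reachable c d T (fun x => p1 x + p2 x) (fun x => q1 x + q2 x).
Proof.
move=> [w1 [w2 [X [Y [sw1 sw2 hw1 hw2 H]]]]].
move=> [v1 [v2 [X' [Y' [sv1 sv2 hv1 hv2 H']]]]].
exists (fun t => w1 t + v1 t), (fun t => w2 t + v2 t).
exists (fun t x => X t x + X' t x), (fun t x => Y t x + Y' t x).
split; [exact: smoothD|exact: smoothD| | |].
- by move=> t ht; rewrite hw1 // hv1 // addr0.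
- by move=> t ht; rewrite hw2 // hv2 // addr0.
move=> omega; have [[-> ->] [-> ->] D] := H omega.
have [[-> ->] [-> ->] D'] := H' omega.
split; [by rewrite addr0|by []|move=> t /[dup] /D[DX DY] /D'[DX' DY']; split].
  by apply: (is_derive_eq (is_deriveD DX DX')); ring.
by apply: (is_derive_eq (is_deriveD DY DY')); ring.
Qed.

Lemma reachableZ c d T k p q : reachable c d T p q ->
  reachable c d T (fun x => k * p x) (fun x => k * q x).
Proof.
move=> [w1 [w2 [X [Y [sw1 sw2 hw1 hw2 H]]]]].
exists (fun t => k * w1 t), (fun t => k * w2 t).
exists (fun t x => k * X t x), (fun t x => k * Y t x).
split; [exact: smoothZ|exact: smoothZ| | |].
- by move=> t ht; rewrite hw1 // mulr0.
- by move=> t ht; rewrite hw2 // mulr0.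
move=> omega; have [[-> ->] [-> ->] D] := H omega.
split; [by rewrite mulr0|by []|move=> t /D[DX DY]; split].
  by apply: (is_derive_eq (is_deriveZ k DX)); rewrite /GRing.scale /=; ring.
by apply: (is_derive_eq (is_deriveZ k DY)); rewrite /GRing.scale /=; ring.
Qed.

Lemma reachable_mul_i c d T p q : reachable c d T p q ->
  reachable c d T (fun x => - q x) p.
Proof.
move=> [w1 [w2 [X [Y [sw1 sw2 hw1 hw2 H]]]]].
exists (fun t => - w2 t), w1, (fun t x => - Y t x), X.
split; [exact: smoothN|exact: sw1| |exact: hw1|].
- by move=> t ht; rewrite hw2 // oppr0.
move=> omega; have [[-> ->] [-> ->] D] := H omega.
split; [by rewrite oppr0|by []|move=> t /D[DX DY]; split].
  by apply: (is_derive_eq (is_deriveN DY)); ring.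
by apply: (is_derive_eq DX); ring.
Qed.

(** If [Z] is the solution for [w], then [omega Z + i w] is the solution for
    [- i w']; at the times [0] and [T] the control vanishes, so that the value
    there is [omega Z]. *)
Lemma reachable_mulX c d T p q : 0 < c -> d < T -> reachable c d T p q ->
  reachable c d T (fun x => x * p x) (fun x => x * q x).
Proof.
move=> c0 dT [w1 [w2 [X [Y [sw1 sw2 hw1 hw2 H]]]]].
exists (w2^`())%classic, (fun t => - (w1^`())%classic t).
exists (fun t x => x * X t x - w2 t), (fun t x => x * Y t x + w1 t).
have out0 : ~~ (c <= 0 <= d) by rewrite negb_and -ltNge c0.
have outT : ~~ (c <= T <= d) by rewrite negb_and -!ltNge dT orbT.
split; [exact: smooth_derive1| |exact: supported_derive1| |].
- by apply: smoothN; exact: smooth_derive1.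
- by move=> t ht; rewrite (supported_derive1 sw1 hw1) // oppr0.
move=> omega; have [[-> ->] [-> ->] D] := H omega.
rewrite !(hw1 _ out0, hw1 _ outT, hw2 _ out0, hw2 _ outT) !(subr0, addr0) mulr0.
split; [by []|by []|].
move=> t /D[DX DY]; split.
  apply: (is_derive_eq (is_deriveB (is_deriveZ omega DX)
    (smooth_is_derive t sw2))).
  by rewrite /GRing.scale /=; ring.
apply: (is_derive_eq (is_deriveD (is_deriveZ omega DY)
  (smooth_is_derive t sw1))).
by rewrite /GRing.scale /=; ring.
Qed.

Lemma eq_reachable c d T p q p' q' : p =1 p' -> q =1 q' ->
  reachable c d T p q -> reachable c d T p' q'.
Proof. by move=> /funext -> /funext ->. Qed.

Lemma reachable_poly c d T p q P : 0 < c -> d < T -> reachable c d T p q ->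
  reachable c d T (fun x => P.[x] * p x) (fun x => P.[x] * q x).
Proof.
move=> c0 dT H; elim/poly_ind: P => [|P k IHP].
  by apply: eq_reachable (reachableZ 0 H) => x; rewrite horner0.
apply: eq_reachable (reachableD (reachable_mulX c0 dT IHP) (reachableZ k H)) => x;
  by rewrite hornerMXaddC; ring.
Qed.

(** Multiplication by the complex polynomial [P + i Q]. *)
Lemma reachable_cpoly c d T p q P Q : 0 < c -> d < T -> reachable c d T p q ->
  reachable c d T (fun x => P.[x] * p x - Q.[x] * q x)
    (fun x => P.[x] * q x + Q.[x] * p x).
Proof.
move=> c0 dT H.
exact: reachableD (reachable_poly P c0 dT H)
  (reachable_mul_i (reachable_poly Q c0 dT H)).
Qed.

End Reachable.

(** * A reachable target without zeros *)

Section Base.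
Variable R : realType.
Implicit Types (f g F dF : R -> R) (c d t m T K omega : R).

Lemma lipschitz_continuous F K :
  (forall x y : R, `|F x - F y| <= K * `|x - y|) -> continuous F.
Proof.
move=> HF x; have K0 : 0 <= K.
  by have := HF 1 0; rewrite subr0 normr1 mulr1; exact: le_trans.
apply/cvgrPdist_lt => e e0; near=> y.
apply: le_lt_trans (HF x y) _.
apply: (@le_lt_trans _ _ ((K + 1) * `|x - y|)); first by rewrite ler_wpM2r // lerDl.
rewrite mulrC -ltr_pdivlMr; last exact: ltr_wpDl.
near: y; apply/nbhs_ballP; exists (e / (K + 1)) => //=.
by apply: divr_gt0 => //; exact: ltr_wpDl.
Unshelve. all: by end_near. Qed.

Lemma derive_bounded_lipschitz F dF K : (forall x : R, is_derive x 1 F (dF x)) ->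
  (forall x, `|dF x| <= K) -> forall x y : R, `|F x - F y| <= K * `|x - y|.
Proof.
move=> DF HK x y.
wlog xy : x y / y < x => [H|].
  have [xy|yx|->] := ltgtP x y; [|exact: H|by rewrite !subrr normr0 mulr0].
  by rewrite distrC [X in _ * X]distrC; exact: H.
have [|z _ ->] := @MVT R F dF y x xy (fun x _ => DF x); last first.
  by rewrite normrM ler_wpM2r.
by apply: derivable_within_continuous => t _; exact: (@ex_derive _ _ _ _ _ _ _ (DF t)).
Qed.

Lemma cos_lipschitz (x y : R) : `|cos x - cos y| <= `|x - y|.
Proof.
rewrite -[X in _ <= X]mul1r.
apply: (@derive_bounded_lipschitz _ (fun x => - sin x)) => z.
by rewrite normrN sin_max.
Qed.

Lemma sin_lipschitz (x y : R) : `|sin x - sin y| <= `|x - y|.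
Proof.
rewrite -[X in _ <= X]mul1r.
apply: (@derive_bounded_lipschitz _ cos) => z; exact: cos_max.
Qed.

(** For [g] the cosine or the sine, these are the components of the Fourier
    integral of [f] up to time [t], centred at [m]. Continuity in [omega]
    comes from the mean value theorem in time: two integrands with parameters
    [x] and [y] differ by at most [T * |x - y|]. *)
Lemma oscillatory_primitive g f m T :
  (forall x y : R, `|g x - g y| <= `|x - y|) ->
  0 < T -> 0 <= m <= T -> continuous f -> (forall t, 0 <= f t <= 1) ->
  exists F : R -> R -> R, [/\ forall omega, F 0 omega = 0,
    forall omega (t : R), -1 < t ->
      is_derive t 1 (F^~ omega) (g (omega * (t - m)) * f t) &
    continuous (F T)].
Proof.
move=> Hg T0 /andP[m0 mT] cf f01.
have cg : continuous g.
  by apply: (@lipschitz_continuous _ 1) => x y; rewrite mul1r.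
have cgf omega : continuous (fun t => g (omega * (t - m)) * f t).
  move=> t; apply: cvgM; last exact: cf.
  apply: (@continuous_comp _ _ _ (fun t => omega * (t - m)) g); last exact: cg.
  by apply: cvgM; [exact: cvg_cst|apply: cvgB; [exact: cvg_id|exact: cvg_cst]].
have [G HG] := choice (fun omega => continuous_primitive (@cgf omega)).
have F0 omega : G omega 0 = 0 by have [] := HG omega.
have DF omega (t : R) : -1 < t ->
    is_derive t 1 (G omega) (g (omega * (t - m)) * f t).
  by have [_] := HG omega; exact.
exists (fun t omega => G omega t); split => //.
apply: (@lipschitz_continuous _ (T * T)) => x y.
have D (t : R) : -1 < t -> is_derive t 1 (G x - G y)
    (g (x * (t - m)) * f t - g (y * (t - m)) * f t).
  by move=> t1; apply: is_deriveB; exact: DF.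
have [z /andP[z0 zT]] := @MVT_after R _ _ 0 T (lexx 0) T0 D.
rewrite !fctE !F0 !subr0 => ->; rewrite normrM (gtr0_norm T0) mulrC -mulrA.
rewrite ler_pM2l // -mulrBl normrM.
have /andP[fz0 fz1] := f01 z; rewrite (ger0_norm fz0).
apply: (@le_trans _ _ `|g (x * (z - m)) - g (y * (z - m))|); first exact: ler_piMr.
apply: le_trans (Hg _ _) _; rewrite -mulrBl normrM mulrC ler_wpM2r //.
by rewrite ler_norml; move: m0 mT z0 zT; lra.
Qed.

(** With [C] and [S] the cosine and sine primitives of the bump [f], the control
    [- f] gives [X + i Y = exp(i omega (t - m)) (C - i S)], a function
    of squared modulus [C ^+ 2 + S ^+ 2]. On a short enough support the cosine
    is positive, so [C] is nondecreasing, and it increases strictly across the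
    support. *)
Lemma reachable_nonvanishing (a b T : R) : 0 < T ->
  exists c d, exists H1 H2 : R -> R, [/\ 0 < c, d < T, reachable c d T H1 H2,
    continuous H1 /\ continuous H2 &
    forall omega, a <= omega <= b -> 0 < H1 omega ^+ 2 + H2 omega ^+ 2].
Proof.
move=> T0; pose m := T / 2; pose K := `|a| + `|b|.
have K0 : 0 <= K by exact: addr_ge0.
have KT : 0 <= K * T by rewrite mulr_ge0 // ltW.
(* This half-width ensures both [r <= T / 4], hence a support inside [(0, T)],
   and [K * r < 1], where [K] bounds [|omega|] on [[a, b]]. *)
pose r := T / 4 / (1 + K * T).
have r0 : 0 < r by rewrite /r !divr_gt0 // ltr_wpDr.
have rT : r <= T / 4.
  by rewrite /r ler_pdivrMr ?ltr_wpDr // ler_peMr ?lerDl // ltW ?divr_gt0.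
have Kr : K * r < 1.
  rewrite /r 2!mulrA ltr_pdivrMr ?ltr_wpDr // mul1r.
  by move: KT; lra.
have [f [sf f_out f_pos f01]] := bump_exists (m - r) (m + r).
have m0T : 0 <= m <= T by rewrite /m; move: T0; lra.
have cf := smooth_continuous sf.
have [C [C0 DC contC]] := oscillatory_primitive cos_lipschitz T0 m0T cf f01.
have [S [S0 DS contS]] := oscillatory_primitive sin_lipschitz T0 m0T cf f01.
pose X t omega :=
  cos (omega * (t - m)) * C t omega + sin (omega * (t - m)) * S t omega.
pose Y t omega :=
  sin (omega * (t - m)) * C t omega - cos (omega * (t - m)) * S t omega.
have contcos : continuous (fun omega => cos (omega * (T - m))).
  by move=> x; apply: continuous_comp; [exact: mulrr_continuous|exact: continuous_cos].
have contsin : continuous (fun omega => sin (omega * (T - m))).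
  by move=> x; apply: continuous_comp; [exact: mulrr_continuous|exact: continuous_sin].
exists (m - r), (m + r), (X T), (Y T); split.
- by move: rT T0; rewrite /m; lra.
- by move: rT T0; rewrite /m; lra.
- exists (fun t => - f t), (fun=> 0), X, Y; split.
  + exact: smoothN.
  + by have := @smoothZ R 0 f sf; congr smooth; apply/funext => t; rewrite mul0r.
  + move=> t; rewrite negb_and -!ltNge => ht; rewrite f_out ?oppr0 //.
    by rewrite negb_and -!leNgt; case/orP: ht => /ltW -> //; rewrite orbT.
  + by [].
  move=> omega.
  split; [by rewrite /X /Y C0 S0 !mulr0 addr0 subr0|by []|move=> t t1].
  have Da : is_derive t 1 (fun s : R => omega * (s - m)) omega.
    have D1 := @is_deriveB R R R _ _ t 1 _ _ (is_derive_id t 1) (is_derive_cst m t 1).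
    apply: (is_derive_eq (@is_deriveZ _ _ _ _ omega _ _ _ D1)).
    by rewrite subr0; exact: mulr1.
  have Dcos := @is_derive1_comp R cos _ t _ _ (is_derive_cos _) Da.
  have Dsin := @is_derive1_comp R sin _ t _ _ (is_derive_sin _) Da.
  have E := cos2Dsin2 (omega * (t - m)).
  split.
    apply: (is_derive_eq (is_deriveD (is_deriveM Dcos (DC _ _ t1))
      (is_deriveM Dsin (DS _ _ t1)))).
    rewrite /GRing.scale /= /Y; move: E.
    set x := cos _; set y := sin _ => E.
    transitivity (- omega * (y * C t omega - x * S t omega) + (x ^+ 2 + y ^+ 2) * f t).
      ring.
    by rewrite E; ring.
  apply: (is_derive_eq (is_deriveB (is_deriveM Dsin (DC _ _ t1))
    (is_deriveM Dcos (DS _ _ t1)))).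
  rewrite /GRing.scale /= /X; ring.
- split=> omega; rewrite /X /Y.
    by apply: cvgD; apply: cvgM;
      [exact: contcos|exact: contC|exact: contsin|exact: contS].
  by apply: cvgB; apply: cvgM;
      [exact: contsin|exact: contC|exact: contcos|exact: contS].
move=> omega oab.
have -> : X T omega ^+ 2 + Y T omega ^+ 2 = C T omega ^+ 2 + S T omega ^+ 2.
  rewrite /X /Y; have := cos2Dsin2 (omega * (T - m)).
  set x := cos _; set y := sin _ => E.
  transitivity ((x ^+ 2 + y ^+ 2) * (C T omega ^+ 2 + S T omega ^+ 2)); first by ring.
  by rewrite E mul1r.
apply: ltr_wpDr; first exact: sqr_ge0.
apply: exprn_gt0.
have cospos t : m - r < t < m + r -> 0 < cos (omega * (t - m)).
  move=> trm; have oK : `|omega| <= K.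
    rewrite /K; move: oab => /andP[oa ob]; rewrite ler_norml.
    have := ler_norm (- a); rewrite normrN; have := ler_norm b.
    by have := normr_ge0 a; have := normr_ge0 b; move: oa ob; lra.
  have small : `|omega * (t - m)| < 1.
    rewrite normrM; apply: le_lt_trans Kr; apply: ler_pM => //.
    by rewrite ler_norml; move: trm; lra.
  apply: cos_gt0_pihalf; move: small; rewrite ltr_norml => /andP[h1 h2].
  by have p1 := @pihalf_ge1 R; apply/andP; split; move: h1 h2 p1; lra.
have dC0 t : 0 <= cos (omega * (t - m)) * f t.
  have [/cospos h|/f_out ->] := boolP (m - r < t < m + r); last by rewrite mulr0.
  by rewrite mulr_ge0 // ?(ltW h) //; have /andP[] := f01 t.
have mr : 0 < m - r by move: rT T0; rewrite /m; lra.
have mrT : m + r < T by move: rT T0; rewrite /m; lra.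
have mm : m - r < m + r by move: r0; lra.
have [z1 _ E1] := MVT_after (lexx 0) mr (DC omega).
have [z2 z2m E2] := MVT_after (ltW mr) mm (DC omega).
have [z3 _ E3] := MVT_after (ltW (lt_trans mr mm)) mrT (DC omega).
have -> : C T omega = (C (m - r) omega - C 0 omega) +
    (C (m + r) omega - C (m - r) omega) + (C T omega - C (m + r) omega).
  by rewrite C0; ring.
rewrite E1 E2 E3; apply: ltr_wpDr.
  by rewrite mulr_ge0 // subr_ge0 ltW.
apply: ltr_wpDl; first by rewrite mulr_ge0 // subr_ge0 ltW.
rewrite mulr_gt0 ?subr_gt0 // mulr_gt0 //; first exact: cospos.
exact: f_pos.
Qed.

End Base.

(** * Complex-valued functions through their real and imaginary parts *)

Section ComplexValued.
Variable R : realType.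
Implicit Types (f g : R -> R) (t a b T : R) (w : R -> Rcomplex R).

Lemma normRcE (x y : R) : `|(x +i* y)%C : Rcomplex R| = Num.sqrt (x ^+ 2 + y ^+ 2).
Proof. by []. Qed.

Lemma normRc_ge_Re (z : Rcomplex R) : `|complex.Re z| <= `|z|.
Proof. by case: z => x y; rewrite normRcE -sqrtr_sqr ler_wsqrtr // lerDl sqr_ge0. Qed.

Lemma normRc_ge_Im (z : Rcomplex R) : `|complex.Im z| <= `|z|.
Proof. by case: z => x y; rewrite normRcE -sqrtr_sqr ler_wsqrtr // lerDr sqr_ge0. Qed.

Lemma normRc_le (x y : R) : `|(x +i* y)%C : Rcomplex R| <= `|x| + `|y|.
Proof.
rewrite normRcE -[leRHS]ger0_norm ?addr_ge0 // -sqrtr_sqr ler_wsqrtr //.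
rewrite sqrrD !real_normK ?num_real // -addrA lerD2l lerDr.
by rewrite mulrn_wge0 // mulr_ge0.
Qed.

Lemma Re_continuous : continuous (@complex.Re R : Rcomplex R -> R).
Proof.
move=> z.
apply/(@cvgrPdist_lt _ _ _ (nbhs z) (nbhs_filter z)) => e e0.
apply/nbhs_ballP; exists e => // u zu.
by rewrite /= -raddfB; apply: le_lt_trans (normRc_ge_Re _) zu.
Qed.

Lemma Im_continuous : continuous (@complex.Im R : Rcomplex R -> R).
Proof.
move=> z.
apply/(@cvgrPdist_lt _ _ _ (nbhs z) (nbhs_filter z)) => e e0.
apply/nbhs_ballP; exists e => // u zu.
by rewrite /= -raddfB; apply: le_lt_trans (normRc_ge_Im _) zu.
Qed.

(** The first hypothesis is linearity in the form in which difference quotients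
    use it. The lemma serves both to take real and imaginary parts of a derivative
    and to assemble a derivative from them. *)
Lemma is_derive_linear (V W : normedModType R) (L : V -> W) (f : R -> V) t df :
  (forall (k : R) u v, L (k *: (u - v)) = k *: (L u - L v)) -> continuous L ->
  is_derive t 1 f df -> is_derive t 1 (L \o f) (L df).
Proof.
move=> linL contL [exf <-].
pose q (h : R) := h^-1 *: ((f \o shift t) (h *: (1 : R)) - f t).
have lim1 : h^-1 *: ((L \o f \o shift t) (h *: (1 : R)) - (L \o f) t) @[h --> 0^']
    --> L ('D_1 f t).
  rewrite (_ : (fun h : R => _) = (fun h => L (q h))); last first.
    by apply/funext => h; rewrite /q linL.
  by apply: (@continuous_cvg _ _ _ _ _ q); [exact: contL|exact: exf].
by apply: DeriveDef; [apply/cvg_ex; exists (L ('D_1 f t))|exact: cvg_lim lim1].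
Qed.

Lemma is_derive_Re w t (dw : Rcomplex R) : is_derive t 1 w dw ->
  is_derive t 1 (fun s => complex.Re (w s)) (complex.Re dw).
Proof.
apply: is_derive_linear; last exact: Re_continuous.
by move=> k [x1 y1] [x2 y2].
Qed.

Lemma is_derive_Im w t (dw : Rcomplex R) : is_derive t 1 w dw ->
  is_derive t 1 (fun s => complex.Im (w s)) (complex.Im dw).
Proof.
apply: is_derive_linear; last exact: Im_continuous.
by move=> k [x1 y1] [x2 y2].
Qed.

Lemma is_derive_complex f g t df dg : is_derive t 1 f df -> is_derive t 1 g dg ->
  is_derive t 1 (fun s => (f s +i* g s)%C : Rcomplex R) ((df +i* dg)%C : Rcomplex R).
Proof.
have scale_lin (z : Rcomplex R) (k u v : R) :
    (k *: (u - v)) *: z = k *: (u *: z - v *: z).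
  by rewrite -scalerBl scalerA.
have decomp (x y : R) :
    ((x +i* y)%C : Rcomplex R) = x *: (1%C : Rcomplex R) + y *: ('i%C : Rcomplex R).
  by apply/eqP; rewrite eq_complex /= !mulr0 !mulr1 addr0 add0r !eqxx.
move=> Df Dg; have := is_deriveD
  (is_derive_linear (scale_lin (1%C : Rcomplex R)) (@scalel_continuous _ _ _) Df)
  (is_derive_linear (scale_lin ('i%C : Rcomplex R)) (@scalel_continuous _ _ _) Dg).
by rewrite -decomp; congr is_derive; apply/funext => s; rewrite decomp.
Qed.

Lemma test_function_pair T c d f g : 0 < c -> d < T ->
  smooth f -> smooth g -> supported_in c d f -> supported_in c d g ->
  test_function T (fun t => (f t +i* g t)%C : Rcomplex R).
Proof.
move=> c0 dT sf sg hf hg.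
have sub : closure [set t | ((f t +i* g t)%C : Rcomplex R) != 0] `<=` `[c, d].
  have /closure_id -> : closed `[c, d] by exact: itv_closed.
  apply: closure_subset => t /= fg; rewrite in_itv /=.
  by apply: contraNT fg => ht; rewrite hf // hg.
split.
- have nth n : ((fun t => (f t +i* g t)%C : Rcomplex R)^`(n))%classic =
      (fun t => ((f^`(n))%classic t +i* (g^`(n))%classic t)%C : Rcomplex R).
    elim: n => [//|n IHn]; rewrite !derive1nS IHn; apply/funext => t.
    rewrite !derive1E.
    have [_ ->] // := is_derive_complex (derivableP (sf n t)) (derivableP (sg n t)).
  move=> n t; rewrite nth.
  exact: (@ex_derive _ _ _ _ _ _ _
    (is_derive_complex (derivableP (sf n t)) (derivableP (sg n t)))).
- apply: subclosed_compact sub; first exact: closed_closure.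
  exact: segment_compact.
- apply: subset_trans sub _ => t /=; rewrite !in_itv /= => /andP[ct td].
  by rewrite (lt_le_trans c0 ct) (le_lt_trans td dT).
Qed.

(** The difference [D] of two solutions satisfies [D' = i omega D], so [|D| ^ 2]
    has zero derivative on the open interval; by continuity it keeps on the
    closed one its initial value, zero. *)
Lemma solution_unique a b T w (Z Z' : R -> R -> Rcomplex R) :
  solution a b T w Z -> solution a b T w Z' ->
  forall t omega : R, t \in `[0, T] -> omega \in `[a, b] -> Z' t omega = Z t omega.
Proof.
move=> solZ solZ' t omega; rewrite in_itv /= => /andP[t0 tT] oab.
have [Z0 cZ dZ] := solZ _ oab; have [Z'0 cZ' dZ'] := solZ' _ oab.
pose D s := Z' s omega - Z s omega.
pose u s := complex.Re (D s); pose v s := complex.Im (D s).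
have dD (s : R) : s \in `]0, T[ ->
    is_derive s 1 D (((omega *i)%C : Rcomplex R) * D s).
  move=> sT; apply: (is_derive_eq (is_deriveB (dZ' s sT) (dZ s sT))).
  by rewrite /D mulrBr opprB addrA subrK.
have dE (s : R) : s \in `]0, t[ ->
    is_derive s 1 (fun s => u s * u s + v s * v s) 0.
  move=> st; have sT : s \in `]0, T[.
    by move: st; rewrite !in_itv /= => /andP[-> /lt_le_trans->].
  have du := is_derive_Re (dD s sT); have dv := is_derive_Im (dD s sT).
  apply: (is_derive_eq (is_deriveD (is_deriveM du du) (is_deriveM dv dv))).
  rewrite /u /v; case: (D s) => x y /=.
  by rewrite /GRing.scale /=; ring.
have cD : {within `[0, t], continuous D}.
  have st : `[0, t] `<=` `[0, T].
    by move=> s /=; rewrite !in_itv /= => /andP[-> /le_trans->].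
  by apply: within_continuousB; apply: continuous_subspaceW st _.
have cE : {within `[0, t], continuous (fun s => u s * u s + v s * v s)}.
  have cu : {within `[0, t], continuous u}.
    by move=> x; apply: continuous_comp; [exact: cD|exact: Re_continuous].
  have cv : {within `[0, t], continuous v}.
    by move=> x; apply: continuous_comp; [exact: cD|exact: Im_continuous].
  by move=> x; apply: cvgD; apply: cvgM; [exact: cu|exact: cu|exact: cv|exact: cv].
have [z _] := MVT_segment t0 dE cE.
have D0 : D 0 = 0 by rewrite /D Z0 Z'0 subrr.
have [u0 v0] : u 0 = 0 /\ v 0 = 0 by rewrite /u /v D0.
rewrite u0 v0 !mul0r addr0 subr0 => /eqP.
rewrite -!expr2 paddr_eq0 ?sqr_ge0 // !sqrf_eq0 => uv.
apply/eqP; rewrite -subr_eq0 -/(D t) eq_complex /=.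
exact: uv.
Qed.

Lemma Linfty_norm_le a b w (M : R) : 0 <= M ->
  (forall x, a < x < b -> `|w x| <= M) -> (Linfty_norm a b w <= M%:E)%E.
Proof.
move=> M0 Hw; rewrite /Linfty_norm unlock; case: ifP => _; last by rewrite lee_fin.
(* The restricted measure does not charge the complement of [`]a, b[]. *)
apply/ess_supP; exists (~` `]a, b[); split.
- by apply: measurableC; exact: measurable_itv.
- by rewrite /= /mrestr setICl measure0.
apply: subsetC => x /=; rewrite in_itv /= => xab.
by rewrite normr_id lee_fin; exact: Hw.
Qed.

End ComplexValued.

(** * Density of the reachable targets *)

Section Density.
Variable R : realType.

(** With [H = H1 + i H2] the profile without zeros, [A + i B] below is the
    quotient [(f1 + i f2) / H], computed with the conjugate of [H]. *)
Lemma reachable_dense (a b T : R) (f1 f2 : R -> R) : a < b -> 0 < T ->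
  {within `[a, b], continuous f1} -> {within `[a, b], continuous f2} ->
  forall e : R, 0 < e -> exists c d, exists p q : R -> R,
    [/\ 0 < c, d < T, reachable c d T p q &
      forall x, a <= x <= b -> `|p x - f1 x| <= e /\ `|q x - f2 x| <= e].
Proof.
move=> ab T0 cf1 cf2 e e0.
have [c [d [H1 [H2 [c0 dT H [cH1 cH2] Hpos]]]]] := reachable_nonvanishing a b T0.
exists c, d; pose N x := H1 x ^+ 2 + H2 x ^+ 2.
have cN : continuous N.
  by move=> x; apply: cvgD; apply: cvgM;
    [exact: cH1|exact: cH1|exact: cH2|exact: cH2].
have cH1' : {within `[a, b], continuous H1} by exact: continuous_subspaceT.
have cH2' : {within `[a, b], continuous H2} by exact: continuous_subspaceT.
have cN' : {within `[a, b], continuous N} by exact: continuous_subspaceT.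
have cV : {within `[a, b], continuous (fun x => (N x)^-1)}.
  apply: continuous_in_subspaceT => x /set_mem /=; rewrite in_itv /= => xab.
  by apply: continuousV; [rewrite gt_eqF // Hpos|exact: cN].
pose A x := (f1 x * H1 x + f2 x * H2 x) * (N x)^-1.
pose B x := (f2 x * H1 x - f1 x * H2 x) * (N x)^-1.
have cA : {within `[a, b], continuous A}.
  move=> x; apply: cvgM; last exact: cV.
  by apply: cvgD; apply: cvgM; [exact: cf1|exact: cH1'|exact: cf2|exact: cH2'].
have cB : {within `[a, b], continuous B}.
  move=> x; apply: cvgM; last exact: cV.
  by apply: cvgB; apply: cvgM; [exact: cf2|exact: cH1'|exact: cf1|exact: cH2'].
have [M1 M10 HM1] := segment_bounded (ltW ab) cH1'.
have [M2 M20 HM2] := segment_bounded (ltW ab) cH2'.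
have M0 : 0 < M1 + M2 by exact: addr_gt0.
have e'0 : 0 < e / (M1 + M2) by exact: divr_gt0.
have [P HP] := weierstrass ab cA e'0.
have [Q HQ] := weierstrass ab cB e'0.
exists (fun x => P.[x] * H1 x - Q.[x] * H2 x), (fun x => P.[x] * H2 x + Q.[x] * H1 x).
split; [exact: c0|exact: dT|exact: reachable_cpoly|].
move=> x xab; have Nx : H1 x ^+ 2 + H2 x ^+ 2 != 0 by rewrite gt_eqF // Hpos.
have E1 : f1 x = A x * H1 x - B x * H2 x by rewrite /A /B /N; field.
have E2 : f2 x = A x * H2 x + B x * H1 x by rewrite /A /B /N; field.
(* Each component of the error [(P + i Q - (A + i B)) * (H1 + i H2)] is a sum of
   two such products. *)
have dev (u v h k r s : R) : `|u| <= e / (M1 + M2) -> `|v| <= e / (M1 + M2) ->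
    `|h| <= r -> `|k| <= s -> r + s = M1 + M2 -> `|u * h| + `|v * k| <= e.
  move=> hu hv hh hk rs; rewrite !normrM.
  apply: (@le_trans _ _ (e / (M1 + M2) * r + e / (M1 + M2) * s)).
    by apply: lerD; apply: ler_pM.
  by rewrite -mulrDr rs divfK // gt_eqF.
have [hP hQ] := (HP x xab, HQ x xab); have [h1 h2] := (HM1 x xab, HM2 x xab).
split.
  rewrite E1 (_ : _ - _ = (P.[x] - A x) * H1 x - (Q.[x] - B x) * H2 x); last by ring.
  by apply: le_trans (ler_normB _ _) _; exact: (dev _ _ _ _ _ _ hP hQ h1 h2).
rewrite E2 (_ : _ - _ = (P.[x] - A x) * H2 x + (Q.[x] - B x) * H1 x); last by ring.
by apply: le_trans (ler_normD _ _) _; apply: (dev _ _ _ _ _ _ hP hQ h2 h1); rewrite addrC.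
Qed.

End Density.

Theorem proposition2 (R : realType) (a b T eta : R) (Zf : R -> Rcomplex R)
    (hab : a < b) (hT : 0 < T) (hZf : {within `[a, b], continuous Zf})
    (heta : 0 < eta) :
  exists w : R -> Rcomplex R, test_function T w /\
    exists Z : R -> R -> Rcomplex R,
      [/\ solution a b T w Z,
          forall Z' : R -> R -> Rcomplex R, solution a b T w Z' ->
            forall t omega : R, t \in `[0, T] -> omega \in `[a, b] ->
              Z' t omega = Z t omega &
          (Linfty_norm a b (fun omega => Z T omega - Zf omega)%R < eta%:E)%E].
Proof.
have cRe : {within `[a, b], continuous (fun x => complex.Re (Zf x))}.
  by move=> x; apply: continuous_comp; [exact: hZf|exact: Re_continuous].
have cIm : {within `[a, b], continuous (fun x => complex.Im (Zf x))}.
  by move=> x; apply: continuous_comp; [exact: hZf|exact: Im_continuous].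
have e0 : 0 < eta / 4 by exact: divr_gt0.
have [c [d [p [q [c0 dT H close]]]]] := reachable_dense hab hT cRe cIm e0.
have [w1 [w2 [X [Y [sw1 sw2 hw1 hw2 XY]]]]] := H.
pose w (t : R) : Rcomplex R := (w1 t +i* w2 t)%C.
pose Z (t omega : R) : Rcomplex R := (X t omega +i* Y t omega)%C.
have solZ : solution a b T w Z.
  move=> omega _; have [[X0 Y0] _ D] := XY omega.
  have DZ (t : R) : 0 <= t -> is_derive t 1 (Z^~ omega)
      (((omega *i)%C : Rcomplex R) * Z t omega - w t).
    move=> t0; have /D[DX DY] : -1 < t by apply: lt_le_trans t0; rewrite ltrN10.
    apply: (is_derive_eq (is_derive_complex DX DY)).
    by apply/eqP; rewrite eq_complex /=; apply/andP; split; apply/eqP; ring.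
  split; first by rewrite /Z X0 Y0.
    apply: derivable_within_continuous => t; rewrite in_itv /= => /andP[t0 _].
    exact: (@ex_derive _ _ _ _ _ _ _ (DZ t t0)).
  by move=> t; rewrite in_itv /= => /andP[/ltW t0 _]; exact: DZ.
exists w; split; first exact: test_function_pair c0 dT sw1 sw2 hw1 hw2.
exists Z; split; [exact: solZ|by move=> Z' /(solution_unique solZ)|].
apply: (@le_lt_trans _ _ (eta / 2)%:E); last first.
  by rewrite lte_fin ltr_pdivrMr // ltr_pMr // ltr1n.
apply: Linfty_norm_le => [|x /andP[ax xb]]; first by rewrite ltW // divr_gt0.
have [_ [XT YT] _] := XY x.
have /close : a <= x <= b by rewrite !ltW.
rewrite /Z XT YT; case: (Zf x) => u v /= [hu hv].
apply: le_trans (normRc_le _ _) _.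
by move: hu hv; lra.
Qed.
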